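(* Let $f:2^V\to\mathbb{R}_{\ge0}$ be monotone submodular with $f(\{v\})>0$ for all $v\in V$, let $k\ge1$ and $1\le W'\le W$ be integers, let $\epsilon\in(0,1)$, and let $v_1,v_2,\dots$ be a stream of elements of $V$. Let $L$ be an upper bound on the time of each evaluation of $f$ and $\Phi=\max_{v\in V}f(\{v\})/\min_{v\in V}f(\{v\})$. Then the algorithm $\mathsf{BidirectionalAlg}$ (described in the context) with sub-window size $W'$ and $\delta=\epsilon$ has an average update time of $O(Lk\log(k\Phi)W/(W'\epsilon))$ per element and uses memory (number of stored elements) $O\big(W'+k^2\log(k\Phi)W/(W'\epsilon)\big)$.
   Context: Active window: $A_t=\{v_{\max(1,t-W+1)},\dots,v_t\}$; $f'_S(v)=f(S\cup\{v\})-f(S)$; $\Delta=\max_{v\in V}f(\{v\})$. Algorithm $\mathsf{BidirectionalAlg}$ (parameters $W'$, $\delta$): Sub-window $i\ge1$ consists of times $(i-1)W'+1,\dots,iW'$. For $i\ge1$, $T_i=\{(1+\delta)^jf(\{v_{iW'}\})/(2k): j=0,\dots,m_i\}$ with $m_i=\lfloor\log_{1+\delta}(2k\Delta/f(\{v_{iW'}\}))\rfloor$; $T_0=\{(1+\delta)^jf(\{v_1\})/(2k): j=0,\dots,m_0\}$ with $m_0=\lfloor\log_{1+\delta}(2k\Delta/f(\{v_1\}))\rfloor$, and $\mathcal S^0_\tau$ consists of the single set $S^{0,0}_\tau=\emptyset$ for each $\tau\in T_0$. At each time $t$: (a) if $t=iW'$ for an integer $i\ge1$, then for each $\tau\in T_i$: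 set $B\leftarrow\emptyset$, $S^{i,t}_\tau\leftarrow\emptyset$, and for $t'=t,t-1,\dots,t-W'+1$, if $f'_B(v_{t'})\ge\tau$ and $|B|<k$, add $v_{t'}$ to $B$ and create $S^{i,t'}_\tau\leftarrow$ a copy of $B$; $\mathcal S^i_\tau$ is the collection of all sets $S^{i,t'}_\tau$ so created. (b) Let $i_t=\max\{0,\lceil(t-W+1)/W'\rceil\}$. For every $i$ with $i_t\le i\le\lceil t/W'\rceil-1$, every $\tau\in T_i$ and every $S^{i,t'}_\tau\in\mathcal S^i_\tau$: if $f'_{S^{i,t'}_\tau}(v_t)\ge\tau$ and $|S^{i,t'}_\tau|<k$, add $v_t$ to it. Sets belonging to sub-windows $i<i_t$ are discarded, and the last $W'$ stream elements are kept to perform step (a). (c) For each $\tau\in T_{i_t}$ let $S^{i_t,t^*}_\tau$ be the set in $\mathcal S^{i_t}_\tau$ with minimum $t^*$ such that $S^{i_t,t^*}_\tau\subseteq A_t$; return $\max_{\tau\in T_{i_t}}f(S^{i_t,t^*}_\tau)$.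
   Formalization: log(kΦ) is read as max(1, log_2(kΦ)): as written the bounds fail for k=Φ=1, where log(kΦ)=0 although f is evaluated at every step; elementary operations other than evaluations of f are charged at most L each (possibly 0). *)

(* Defs.v *)
From mathcomp Require Import all_boot all_order all_algebra.
From mathcomp Require Import reals exp.

Set Implicit Arguments.
Unset Strict Implicit.
Unset Printing Implicit Defensive.

Import Order.TTheory GRing.Theory Num.Theory.
Local Open Scope ring_scope.

Section SetFunctions.
Context {R : realType} {V : finType}.
Implicit Types (f : {set V} -> R) (S A B : {set V}) (x : V).

Definition marg f S x : R := f (x |: S) - f S.

Definition monotone_setfun f : Prop := forall A B, A \subset B -> f A <= f B.

Definition submodular f : Prop :=
  forall A B x, A \subset B -> x \notin B -> marg f B x <= marg f A x.

(* For f >= 0 and V nonempty, the default values 0 and [max_single f] of the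
   iterated operators do not affect the maximum and the minimum. *)
Definition max_single f : R := \big[Num.max/0]_(x : V) f [set x].
Definition min_single f : R := \big[Num.min/max_single f]_(x : V) f [set x].
Definition Phi f : R := max_single f / min_single f.

End SetFunctions.

Definition logb {R : realType} (b x : R) : R := ln x / ln b.

(* ceil (a / b) for b > 0; with a truncated difference a = c - d this is
   max (0, ceil ((c - d) / b)). *)
Definition ceildiv (a b : nat) : nat := ((a + b.-1) %/ b)%N.

(* A computation is a pair (running time, result). *)
Definition comp (R : realType) (A : Type) : Type := (R * A)%type.

Section Computations.
Context {R : realType}.

Definition ret {A : Type} (a : A) : comp R A := (0, a).

Definition bind {A B : Type} (m : comp R A) (g : A -> comp R B) : comp R B :=
  (m.1 + (g m.2).1, (g m.2).2).

Fixpoint mapM {A B : Type} (g : A -> comp R B) (s : seq A) : comp R (seq B) :=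
  if s is a :: s' then
    bind (g a) (fun b => bind (mapM g s') (fun bs => ret (b :: bs)))
  else ret [::].

Fixpoint foldM {A B : Type} (g : B -> A -> comp R B) (b : B) (s : seq A) :
    comp R B :=
  if s is a :: s' then bind (g b a) (fun b' => foldM g b' s') else ret b.

End Computations.

Notation "'let*' x ':=' m 'in' e" := (bind m (fun x => e))
  (at level 200, x pattern, m at level 100, e at level 200,
   format "'let*'  x  ':='  m  'in' '//' e").

(* The collection S^i_tau of one threshold tau: pairs (t', S^{i,t'}_tau) listed
   by strictly increasing t'. *)
Definition collection (V : finType) : Type := seq (nat * {set V}).

(* A sub-window i: its index and, for every tau in T_i, the pair
   (tau, S^i_tau). *)
Definition subwindow (R : realType) (V : finType) : Type :=
  (nat * seq (R * collection V))%type.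

(* [buf]: the last elements of the stream with their arrival times, most recent
   first; [subs]: the sub-windows that have not been discarded. *)
Record state (R : realType) (V : finType) : Type := State {
  buf : seq (nat * V);
  subs : seq (subwindow R V) }.

(* The outcome of one time step: the new state, the returned value and the
   largest number of elements stored during the step. *)
Record outcome (R : realType) (V : finType) : Type := Outcome {
  next_state : state R V;
  returned : R;
  peak : nat }.

Definition collection_size {V : finType} (c : collection V) : nat :=
  (\sum_(p <- c) #|p.2|)%N.

Definition state_size {R : realType} {V : finType} (s : state R V) : nat :=
  (size (buf s) + \sum_(w <- subs s) \sum_(q <- w.2) collection_size q.2)%N.

Section BidirectionalAlg.
Context {R : realType} {V : finType}.
(* [etime S] is the time of evaluating f on S, [otime] that of one elementary
   operation; the algorithm accesses f only through [eval]. The stream is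
   v 1, v 2, ...; [v 0] is never read. *)
Context (f : {set V} -> R) (etime : {set V} -> R) (otime : R).
Context (k W W' : nat) (delta : R) (v : nat -> V).

Definition eval (S : {set V}) : comp R R := (etime S, f S).

Definition tick (n : nat) : comp R unit := (otime *+ n, tt).

Definition eval_marg (S : {set V}) (x : V) : comp R R :=
  let* a := eval (x |: S) in
  let* b := eval S in
  ret (a - b).

(* [Num.truncn] is the floor, the logarithm being nonnegative. *)
Definition thresholds (x : V) : comp R (seq R) :=
  let* fx := eval [set x] in
  let m := Num.truncn (logb (1 + delta) (2 * k%:R * max_single f / fx)) in
  let* _ := tick m.+1 in
  ret [seq (1 + delta) ^+ j * fx / (2 * k%:R) | j <- iota 0 m.+1].

(* Step (a) for one tau at time t; returns the final working set B and the
   collection. Each copy of B takes #|B| operations. The filter overwrites the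
   initial set S^{i,t}_tau = set0 when v_t itself is accepted. *)
Definition backward (t : nat) (b : seq (nat * V)) (tau : R) :
    comp R ({set V} * collection V) :=
  foldM (fun (Bc : {set V} * collection V) (p : nat * V) =>
      let* g := eval_marg Bc.1 p.2 in
      let* _ := tick 1 in
      if (tau <= g) && (#|Bc.1| < k)%N then
        let B := p.2 |: Bc.1 in
        let* _ := tick #|B| in
        ret (B, (p.1, B) :: [seq q <- Bc.2 | q.1 != p.1])
      else ret Bc)
    (set0, [:: (t, set0)]) b.

(* Step (a); the result lists (tau, (B, S^i_tau)) for tau in T_i. *)
Definition build (t : nat) (x : V) (b : seq (nat * V)) :
    comp R (seq (R * ({set V} * collection V))) :=
  let* T := thresholds x in
  mapM (fun tau => let* c := backward t b tau in ret (tau, c)) T.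

(* Step (b) for one sub-window. *)
Definition forward (x : V) (w : subwindow R V) : comp R (subwindow R V) :=
  let* qs := mapM (fun q : R * collection V =>
      let* c := mapM (fun p : nat * {set V} =>
          let* g := eval_marg p.2 x in
          let* _ := tick 1 in
          ret (p.1, if (q.1 <= g) && (#|p.2| < k)%N then x |: p.2 else p.2))
        q.2 in
      ret (q.1, c)) w.2 in
  ret (w.1, qs).

Definition active (t : nat) : {set V} :=
  [set x in [seq v s | s <- index_iota (maxn 1 (t.+1 - W)) t.+1]].

Definition first_sub (t : nat) : nat := ceildiv (t.+1 - W) W'.

(* Step (c). Testing S \subset A_t is one operation: when the elements of S are
   kept in the order of their last arrival (which costs O(1) per set and time
   step), only the oldest one has to be looked at. As collections are listed by
   increasing t', the first set passing the test is the one with minimal t'. *)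
Definition select (t : nat) (ws : seq (subwindow R V)) : comp R R :=
  let* vals := mapM (fun q : R * collection V =>
      let* _ := tick (size q.2).+1 in
      eval (head set0 [seq p.2 | p : nat * {set V} <- q.2 & p.2 \subset active t]))
    (flatten [seq w.2 | w <- ws & w.1 == first_sub t]) in
  ret (\big[Num.max/0]_(a <- vals) a).

(* Sub-window 0, created when v_1 arrives. *)
Definition init_subs (t : nat) (x : V) (ws : seq (subwindow R V)) :
    comp R (seq (subwindow R V)) :=
  if t == 1%N then
    let* T := thresholds x in
    ret [:: (0%N, [seq (tau, [:: (0%N, set0)]) | tau <- T])]
  else ret ws.

(* Time step t. The peak counts the state at the end of step (a), before any
   sub-window is discarded and with the working sets B of all tau, and the state
   after step (b). Within (a), and within (b) after the discarding, the number
   of stored elements only grows, so no other moment uses more memory. *)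
Definition step (s : state R V) (t : nat) : comp R (outcome R V) :=
  let x := v t in
  let* _ := tick 1 in
  let b := take W' ((t, x) :: buf s) in
  let* ws0 := init_subs t x (subs s) in
  let* new := if (W' %| t)%N then build t x b else ret [::] in
  let ws1 :=
    if (W' %| t)%N then
      rcons ws0 ((t %/ W')%N, [seq (q.1, q.2.2) | q <- new])
    else ws0 in
  let mem_a :=
    (state_size (State b ws1) + \sum_(q <- new) #|q.2.1|)%N in
  let* _ := tick (size ws1) in
  let kept := [seq w <- ws1 | (first_sub t <= w.1)%N] in
  let* ws2 := mapM (fun w : subwindow R V =>
      if (w.1 < ceildiv t W')%N then forward x w else ret w) kept in
  let s' := State b ws2 in
  let* r := select t ws2 in
  ret (Outcome s' r (maxn mem_a (state_size s'))).

(* [run t] is the state after time t. *)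
Fixpoint run (t : nat) : state R V :=
  if t is t'.+1 then next_state (step (run t') t).2 else State [::] [::].

Definition output (t : nat) : R := returned (step (run t.-1) t).2.

Definition update_time (t : nat) : R := (step (run t.-1) t).1.

Definition average_update_time (n : nat) : R :=
  (\sum_(1 <= t < n.+1) update_time t) / n%:R.

Definition memory (t : nat) : nat := peak (step (run t.-1) t).2.

End BidirectionalAlg.

(* Main.v *)
(* Each T_i has at most M = O(log(k Phi) / eps) thresholds because
   ln (1 + eps) >= eps / 2, and the indices of the sub-windows alive at time t
   lie between ceil((t - W + 1) / W') and floor(t / W'), so there are at most
   N = floor(W / W') + 1 of them. Since tau > 0, an accepted element strictly
   enlarges the working set B, so a collection has at most k + 1 sets, each of
   size at most k: the memory is W' + O(N M k^2), and a step without
   construction costs O(N M k L). Constructing a sub-window costs O(M W' k L),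
   but happens only once in W' steps. *)
Require Import Defs.
From mathcomp Require Import all_boot all_order all_algebra.
From mathcomp Require Import reals exp.
From mathcomp Require Import zify ring lra.

Import Order.TTheory GRing.Theory Num.Theory.
Local Open Scope ring_scope.

(** * Time and result of iterated computations *)

Section Computations.
Context {R : realType} {A B : Type}.

Lemma mapM_time (g : A -> Defs.comp R B) (s : seq A) :
  (mapM g s).1 = \sum_(a <- s) (g a).1.
Proof.
elim: s => [|a s IHs] /=; first by rewrite big_nil.
by rewrite big_cons IHs addr0.
Qed.

Lemma mapM_result (g : A -> Defs.comp R B) (s : seq A) :
  (mapM g s).2 = [seq (g a).2 | a <- s].
Proof. by elim: s => //= a s ->. Qed.

(** Result and time are bounded together because the bound [c] on one iteration is available only
    while the accumulator satisfies [P]. *)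
Lemma foldM_invariant (P : B -> Prop) (g : B -> A -> Defs.comp R B) (c : R)
    (b : B) (s : seq A) :
  P b -> (forall b' a, P b' -> P (g b' a).2 /\ (g b' a).1 <= c) ->
  P (foldM g b s).2 /\ (foldM g b s).1 <= c * (size s)%:R.
Proof.
move=> Pb gP; elim: s b Pb => [|a s IHs] b Pb /=; first by rewrite mulr0.
have [Pg gc] := gP b a Pb; have [Pf fc] := IHs _ Pg.
by split=> //; rewrite mulrS mulrDr mulr1 lerD.
Qed.

Lemma ler_sum_all (P : pred A) (F : A -> R) (c : R) (s : seq A) :
  all P s -> (forall a, P a -> F a <= c) -> \sum_(a <- s) F a <= c * (size s)%:R.
Proof.
move=> Ps FP; elim: s Ps => [_|a s IHs /= /andP[Pa Ps]].
  by rewrite big_nil mulr0.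
by rewrite big_cons mulrS mulrDr mulr1 lerD ?FP ?IHs.
Qed.

End Computations.

Lemma leq_sum_all (A : Type) (P : pred A) (F : A -> nat) (c : nat) (s : seq A) :
  all P s -> (forall a, P a -> F a <= c)%N -> (\sum_(a <- s) F a <= size s * c)%N.
Proof.
move=> Ps FP; elim: s Ps => [_|a s IHs /= /andP[Pa Ps]]; first by rewrite big_nil.
by rewrite big_cons mulSn leq_add ?FP ?IHs.
Qed.

Lemma leq_ceildiv_mul (a b : nat) : (0 < b)%N -> (a <= ceildiv a b * b)%N.
Proof.
move=> b_gt0; rewrite /ceildiv; have := divn_eq (a + b.-1) b.
by have := ltn_pmod (a + b.-1) b_gt0; lia.
Qed.

(** * Cost of the single procedures, for any uniform bound [M] on the number of thresholds *)

Section Cost.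
Context {R : realType} {V : finType}.
Context (f : {set V} -> R) (etime : {set V} -> R) (otime L : R).
Context (k W W' : nat) (delta : R) (v : nat -> V) (M : nat).
Context (f_gt0 : forall x, 0 < f [set x]).
Context (k_gt0 : (0 < k)%N) (W'_gt0 : (0 < W')%N) (leW'W : (W' <= W)%N).
Context (delta_gt0 : 0 < delta).
Context (etimeP : forall S, 0 <= etime S <= L) (otimeP : 0 <= otime <= L).
Context (thresholds_size :
  forall x, (size (thresholds f etime otime k delta x).2 <= M)%N).

Let L_ge0 : 0 <= L. Proof. by case/andP: otimeP => /le_trans; apply. Qed.
Let etime_le S : etime S <= L. Proof. by case/andP: (etimeP S). Qed.
Let otime_le : otime <= L. Proof. by case/andP: otimeP. Qed.
Let tick_le (m n : nat) : (m <= n)%N -> otime *+ m <= L * n%:R.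
Proof.
move=> le_mn; rewrite mulr_natr; apply: (@le_trans _ _ (L *+ m)).
  exact: ler_wMn2r.
exact: ler_wpMn2l.
Qed.

(** The bound [k.+1] counts the initial empty set and one copy for each of at most [k] accepted
    elements. *)
Definition small_collection (c : collection V) : bool :=
  (size c <= k.+1)%N && all (fun p : nat * {set V} => #|p.2| <= k)%N c.

Definition small_subwindow (w : subwindow R V) : bool :=
  (size w.2 <= M)%N && all (fun q : R * collection V => small_collection q.2) w.2.

Lemma thresholds_gt0 x : all (> 0) (thresholds f etime otime k delta x).2.
Proof.
apply/allP => _ /mapP[j _ ->].
rewrite divr_gt0 ?mulr_gt0 ?exprn_gt0 ?ltr0n ?addr_gt0 ?f_gt0 //.
Qed.

Lemma thresholds_time x :
  (thresholds f etime otime k delta x).1 <= L * (M%:R + 1).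
Proof.
have := thresholds_size x; rewrite /thresholds /= size_map size_iota => leM.
by rewrite addr0 addrC mulrDr mulr1 lerD ?etime_le ?tick_le.
Qed.

(** Each buffered element costs two evaluations, one comparison and a copy of at most [k] elements,
    whence [k + 3]. *)
Lemma backward_spec t b tau : 0 < tau ->
  let r := backward f etime otime k t b tau in
  [/\ (#|r.2.1| <= k)%N, small_collection r.2.2
    & r.1 <= L * (k%:R + 3) * (size b)%:R].
Proof.
move=> tau_gt0 /=; rewrite /backward.
set g := (X in foldM X).
(* The collection is measured against the working set: it has at most one set more than [B] has
   elements. *)
pose P (Bc : {set V} * collection V) := [/\ (#|Bc.1| <= k)%N,
  (size Bc.2 <= #|Bc.1|.+1)%N & all (fun p : nat * {set V} => #|p.2| <= k)%N Bc.2].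
have P0 : P (set0, [:: (t, set0)]) by rewrite /P /= cards0.
have gP Bc p : P Bc -> P (g Bc p).2 /\ (g Bc p).1 <= L * (k%:R + 3).
  case: Bc => B c [/= cardB sizec allc]; rewrite /g /=.
  have time3 : etime (p.2 |: B) + etime B + (otime + L * k%:R)
      <= L * (k%:R + 3).
    have := etime_le (p.2 |: B); have := etime_le B; have := otime_le; lra.
  case: ifP => [/andP[le_tau ltBk]|_] /=; last first.
    split=> //; rewrite mulr1n !addr0; apply: le_trans time3.
    by rewrite !lerD // lerDl mulr_ge0.
  (* A member of [B] has marginal value 0, below the positive threshold, so an accepted element is
     new. *)
  have xB : p.2 \notin B.
    apply: contraL le_tau => xB.
    by rewrite (setUidPr _) ?sub1set // subrr -ltNge.
  have cardB' : #|p.2 |: B| = #|B|.+1 by rewrite cardsU1 xB.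
  split; last first.
    apply: le_trans time3; rewrite mulr1n !addr0 !lerD //.
    by rewrite tick_le // cardB'.
  split=> /=; rewrite ?cardB' //.
    (* The filter can only shorten the list, so an acceptance adds at most one set. *)
    rewrite ltnS (leq_trans _ sizec) // size_filter count_size //.
  rewrite ltBk /= all_filter; apply: sub_all allc => q /= ->.
  by rewrite implybT.
have [[cardB sizec allc] time] := foldM_invariant P g _ _ b P0 gP.
by split=> //; rewrite /small_collection (leq_trans sizec) // ltnS.
Qed.

Lemma build_spec t x b : (size b <= W')%N ->
  let r := build f etime otime k delta t x b in
  [/\ (size r.2 <= M)%N,
      all (fun q : R * ({set V} * collection V) => (#|q.2.1| <= k)%N && small_collection q.2.2) r.2
    & r.1 <= L * (M%:R + 1) + L * (k%:R + 3) * W'%:R * M%:R].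
Proof.
move=> sizeb; rewrite /build.
have := thresholds_size x; have := thresholds_gt0 x; have := thresholds_time x.
case: (thresholds _ _ _ _ _ _) => c T /= timeT allT sizeT.
rewrite mapM_time mapM_result size_map all_map; split=> //.
  by apply: sub_all allT => tau tau_gt0 /=; have [-> ->] := backward_spec t b tau tau_gt0.
rewrite lerD //.
have C0 : 0 <= L * (k%:R + 3) by rewrite mulr_ge0 // addr_ge0.
apply: (@le_trans _ _ (L * (k%:R + 3) * W'%:R * (size T)%:R)); last first.
  by rewrite ler_wpM2l ?ler_nat // mulr_ge0.
apply: ler_sum_all allT _ => tau tau_gt0 /=; rewrite addr0.
have [_ _ /le_trans] := backward_spec t b tau tau_gt0; apply.
by rewrite ler_wpM2l ?ler_nat.
Qed.

(** The factor 3 is two evaluations and one comparison per set. The test [#|p.2| < k] preserves the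
    size bound, as an insertion adds at most one element. *)
Lemma forward_spec x w : small_subwindow w ->
  let r := forward f etime otime k x w in
  [/\ r.2.1 = w.1, small_subwindow r.2 & r.1 <= L * 3 * k.+1%:R * M%:R].
Proof.
case: w => i qs /andP[/= sizeq allq]; rewrite /forward /=; split=> //.
  rewrite /small_subwindow /= mapM_result size_map sizeq all_map /=.
  apply: sub_all allq => -[tau c] /andP[/= sizec allc].
  rewrite /small_collection mapM_result size_map sizec all_map /=.
  apply: sub_all allc => p /= le_pk; case: ifP => // /andP[_ lt_pk].
  by rewrite cardsU1; case: (_ \notin _) => //=; rewrite add0n.
rewrite addr0 mapM_time.
have C0 : 0 <= L * 3 by rewrite mulr_ge0.
apply: (@le_trans _ _ (L * 3 * k.+1%:R * (size qs)%:R)); last first.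
  by rewrite ler_wpM2l ?ler_nat // mulr_ge0.
apply: ler_sum_all allq _ => -[tau c] /andP[/= sizec _].
rewrite addr0 mapM_time.
apply: (@le_trans _ _ (L * 3 * (size c)%:R)); last by rewrite ler_wpM2l ?ler_nat.
apply: (ler_sum_all xpredT); first exact: all_predT.
move=> p _ /=; rewrite mulr1n !addr0.
have := etime_le (x |: p.2); have := etime_le p.2; have := otime_le; lra.
Qed.

(** A collection costs at most [k + 2] ticks and one evaluation. The filter on the index is
    estimated crudely, as if it kept every sub-window. *)
Lemma select_time t ws : all small_subwindow ws ->
  (select f etime otime W W' v t ws).1 <= L * (k%:R + 3) * (size ws * M)%:R.
Proof.
move=> allws; rewrite /select /= addr0 mapM_time.
set qs := flatten _.
have [allq sizeq] : all (fun q : R * collection V => small_collection q.2) qs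
    /\ (size qs <= size ws * M)%N.
  rewrite /qs; elim: ws allws {qs} => //= w ws IHws /andP[/andP[sizew allw]].
  move=> /IHws[allq sizeq]; case: ifP => _ /=.
    by rewrite all_cat allw allq size_cat mulSn leq_add.
  by split=> //; rewrite mulSn (leq_trans sizeq) // leq_addl.
apply: (@le_trans _ _ (L * (k%:R + 3) * (size qs)%:R)); last first.
  by rewrite ler_wpM2l ?ler_nat // mulr_ge0 // addr_ge0.
apply: ler_sum_all allq _ => -[tau c] /andP[/= sizec _].
have -> : L * (k%:R + 3) = L * k.+2%:R + L by rewrite -addn2 natrD; ring.
by rewrite lerD ?tick_le.
Qed.

(** * Number of live sub-windows *)

Definition bounded_subwindows (t : nat) (ws : seq (subwindow R V)) : bool :=
  [&& all small_subwindow ws, uniq [seq w.1 | w <- ws]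
    & all (fun i => first_sub W W' t <= i <= t %/ W')%N [seq w.1 | w <- ws]].

Definition max_subwindows : nat := (W %/ W').+1.

(** Distinct indices in an integer interval are at most as many as its points. *)
Lemma bounded_subwindows_size t ws :
  bounded_subwindows t ws -> (size ws <= max_subwindows)%N.
Proof.
case/and3P=> _ uniqi /allP rangei.
have := @uniq_leq_size _ _ (index_iota (first_sub W W' t) (t %/ W').+1) uniqi.
rewrite size_map size_iota => /(_ _)/leq_trans; apply.
  by move=> i /rangei; rewrite mem_index_iota ltnS.
rewrite /max_subwindows; set a := first_sub W W' t.
(* By definition of the ceiling, [t.+1 - W <= a * W']; hence [t <= a * W' + W], which is then
   divided by [W']. *)
suff : (t %/ W' <= a + W %/ W')%N by lia.
rewrite -divnMDl // leq_div2r //.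
by have := leq_ceildiv_mul (t.+1 - W) W' W'_gt0; rewrite -/(first_sub W W' t) -/a; lia.
Qed.

Lemma init_subs_spec t x ws : bounded_subwindows t ws ->
  let r := init_subs f etime otime k delta t.+1 x ws in
  bounded_subwindows t r.2 /\ r.1 <= L * (M%:R + 1).
Proof.
move=> okws; rewrite /init_subs; case: eqP => [[->]|_]; last first.
  by split=> //=; rewrite mulr_ge0 // addr_ge0.
have := thresholds_size x; have := thresholds_time x.
case: (thresholds _ _ _ _ _ _) => c T /= timeT sizeT.
rewrite addr0; split=> //.
rewrite /bounded_subwindows /= /small_subwindow /= size_map sizeT all_map /=.
(* Here [t] is 0: since [W >= 1], the difference [1 - W] truncates to 0, so the admissible range is
   exactly the index 0. *)
rewrite /first_sub /ceildiv div0n leqn0 divn_small ?eqxx ?andbT; last by lia.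
by apply/allP => tau _ /=; rewrite /small_collection /= cards0.
Qed.

(** * Invariant, time and memory of one time step *)

Definition good_state (t : nat) (s : state R V) : bool :=
  (size (buf s) <= W')%N && bounded_subwindows t (subs s).

Lemma state_size_le n (s : state R V) :
  (size (buf s) <= W')%N -> all small_subwindow (subs s) ->
  (size (subs s) <= n)%N -> (state_size s <= W' + n * (M * (k.+1 * k)))%N.
Proof.
move=> sizeb allw sizew; rewrite /state_size leq_add //.
apply: (@leq_trans (size (subs s) * (M * (k.+1 * k)))); last by rewrite leq_mul2r sizew orbT.
apply: leq_sum_all allw _ => w /andP[sizeq allq].
apply: (@leq_trans (size w.2 * (k.+1 * k))); last by rewrite leq_mul2r sizeq orbT.
apply: leq_sum_all allq _ => q /andP[sizec allc].
apply: (@leq_trans (size q.2 * k)); last by rewrite leq_mul2r sizec orbT.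
exact: leq_sum_all allc _.
Qed.

(** The summands are the creation of sub-window 0 together with the initial tick, the discarding
    pass, and the costs of [forward] ([3 * k.+1]) and [select] ([k + 3]) for each sub-window and
    threshold. *)
Definition time_each : R :=
  L * (M%:R + 2 + max_subwindows.+1%:R
       + max_subwindows%:R * M%:R * (3 * k.+1%:R + k%:R + 3)).

Definition time_build : R :=
  L * (M%:R + 1 + (k%:R + 3) * W'%:R * M%:R).

(** Buffer, collections of up to one extra sub-window before discarding, and the working sets [B] of
    the sub-window under construction. *)
Definition memory_bound : nat :=
  W' + max_subwindows.+1 * (M * (k.+1 * k)) + M * k.

Lemma step_spec t s : good_state t s ->
  let r := step f etime otime k W W' delta v s t.+1 in
  [/\ good_state t.+1 (next_state r.2),
      r.1 <= time_each + (W' %| t.+1)%:R * time_build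
    & (peak r.2 <= memory_bound)%N].
Proof.
case/andP=> sizebuf oks; rewrite /step /=.
set x := v t.+1; set b := take _ _.
have sizeb : (size b <= W')%N by rewrite size_take_min geq_minl.
have [] := init_subs_spec t x (subs s) oks.
case: (init_subs _ _ _ _ _ _ _ _) => c0 ws0 /= ok0 time0.
have size0 := bounded_subwindows_size _ _ ok0.
set new := (if _ then build _ _ _ _ _ _ _ _ else _).
have [sizenew allnew timenew] : [/\ (size new.2 <= M)%N,
      all (fun q : R * ({set V} * collection V) => (#|q.2.1| <= k)%N && small_collection q.2.2) new.2
    & new.1 <= (W' %| t.+1)%:R * time_build].
  rewrite /new; case: (W' %| t.+1)%N; last by rewrite mul0r.
  have [? ? time] := build_spec t.+1 x b sizeb; split=> //.
  by rewrite mul1r (le_trans time) // /time_build; lra.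
set ws1 := (if _ then rcons _ _ else _).
(* Before discarding, only the upper bound on the indices is claimed for time [t.+1]; a construction
   may add one sub-window. *)
have [small1 uniq1 range1 size1] : [/\ all small_subwindow ws1,
    uniq [seq w.1 | w <- ws1],
    all (fun i => i <= t.+1 %/ W')%N [seq w.1 | w <- ws1]
    & (size ws1 <= max_subwindows.+1)%N].
  case/and3P: ok0 => small0 uniq0 range0; rewrite /ws1.
  rewrite divnS //; case: (W' %| t.+1)%N => /=; last first.
    rewrite add0n; split=> //; last exact: leqW.
    by apply: sub_all range0 => i /andP[].
  rewrite map_rcons rcons_uniq uniq0 !all_rcons size_rcons ltnS /= leqnn /=.
  split=> //.
  - rewrite small0 andbT /small_subwindow /= size_map sizenew all_map /=.
    by apply: sub_all allnew => q /andP[].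
  (* When [W'] divides [t.+1], the new index is [t %/ W' + 1], larger than all earlier ones. *)
  - rewrite andbT; apply/negP => /(allP range0)/andP[_]; lia.
  - by apply: sub_all range0 => i /andP[_]; lia.
set kept := [seq w <- ws1 | _].
have small_kept : all small_subwindow kept.
  by rewrite all_filter; apply: sub_all small1 => w /= ->; rewrite implybT.
have uniq_kept : uniq [seq w.1 | w <- kept].
  exact: subseq_uniq (map_subseq _ (filter_subseq _ _)) uniq1.
(* The discarding filter is exactly the missing lower bound on the indices. *)
have ok_kept : bounded_subwindows t.+1 kept.
  rewrite /bounded_subwindows small_kept uniq_kept /=.
  move: range1; rewrite !all_map all_filter; apply: sub_all => w /= ->.
  by rewrite andbT implybb.
set h := (X in mapM X kept); rewrite mapM_time mapM_result.
have hP w : small_subwindow w -> [/\ (h w).2.1 = w.1,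
    small_subwindow (h w).2 & (h w).1 <= L * 3 * k.+1%:R * M%:R].
  rewrite /h => smallw; case: ifP => _; first exact: forward_spec.
  by split=> //=; rewrite !mulr_ge0.
set ws2 := [seq (h w).2 | w <- kept].
have small2 : all small_subwindow ws2.
  by rewrite all_map; apply: sub_all small_kept => w /hP[].
have ok2 : bounded_subwindows t.+1 ws2.
  rewrite /bounded_subwindows small2 /=.
  suff -> : [seq w.1 | w <- ws2] = [seq w.1 | w <- kept] by case/and3P: ok_kept => _ -> ->.
  rewrite /ws2; elim: kept small_kept {uniq_kept ok_kept ws2 small2} => //=.
  by move=> w ws IHws /andP[/hP[-> _ _] /IHws->].
have size2 := bounded_subwindows_size _ _ ok2.
split.
- by rewrite /good_state /= sizeb.
- have timeh : \sum_(w <- kept) (h w).1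
      <= L * 3 * k.+1%:R * M%:R * max_subwindows%:R.
    apply: (@le_trans _ _ (L * 3 * k.+1%:R * M%:R * (size kept)%:R)).
      by apply: ler_sum_all small_kept _ => w /hP[].
    by rewrite ler_wpM2l ?mulr_ge0 // ler_nat (bounded_subwindows_size t.+1).
  have times : (select f etime otime W W' v t.+1 ws2).1
      <= L * (k%:R + 3) * (max_subwindows%:R * M%:R).
    apply: le_trans (select_time t.+1 ws2 small2) _.
    by rewrite ler_wpM2l ?mulr_ge0 ?addr_ge0 // -natrM ler_nat leq_mul2r size2 orbT.
  rewrite /select /= in times.
  have := tick_le _ _ size1; have := otime_le.
  rewrite mulr1n /time_each; lra.
- have sum_new : (\sum_(q <- new.2) #|q.2.1| <= M * k)%N.
    apply: (@leq_trans (size new.2 * k)); last by rewrite leq_mul2r sizenew orbT.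
    by apply: leq_sum_all allnew _ => q /andP[].
  rewrite geq_max /memory_bound leq_add ?state_size_le //=.
  apply: leq_trans (leq_addr _ _).
  by rewrite state_size_le // (leq_trans size2).
Qed.

(** * Amortization over the stream *)

Lemma run_good t : good_state t (run f etime otime k W W' delta v t).
Proof.
by elim: t => // t /step_spec[].
Qed.

Lemma memory_le t : (0 < t)%N ->
  (memory f etime otime k W W' delta v t <= memory_bound)%N.
Proof. by case: t => // t _; have [] := step_spec _ _ (run_good t). Qed.

(** A construction happens only at multiples of [W'], and there are [n %/ W'] of these among the
    times 1 to [n]. *)
Lemma total_update_time_le n :
  \sum_(1 <= t < n.+1) update_time f etime otime k W W' delta v t
    <= time_each * n%:R + time_build * (n %/ W')%:R.
Proof.
elim: n => [|n IHn]; first by rewrite big_geq // div0n !mulr0 addr0.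
rewrite big_nat_recr //= divnS // natrD -natr1.
have [_ + _] := step_spec _ _ (run_good n); rewrite -/(update_time _ _ _ _ _ _ _ _ n.+1).
lra.
Qed.

Lemma average_update_time_le n : (0 < n)%N ->
  average_update_time f etime otime k W W' delta v n
    <= time_each + time_build / W'%:R.
Proof.
move=> n_gt0; rewrite /average_update_time ler_pdivrMr ?ltr0n //.
apply: le_trans (total_update_time_le n) _.
rewrite mulrDl lerD2l -[leRHS]mulrA ler_wpM2l //.
  by rewrite /time_build mulr_ge0 // !addr_ge0 // !mulr_ge0 // addr_ge0.
by rewrite mulrC ler_pdivlMr ?ltr0n // -natrM ler_nat leq_divM.
Qed.

End Cost.

(** * Number of thresholds in terms of [Phi] *)

Section Thresholds.
Context {R : realType} {V : finType} (f : {set V} -> R).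
Context (f_gt0 : forall x, 0 < f [set x]).

(** The point [x] makes [V] nonempty, so that the default value [max_single f] of the minimum is
    positive too. *)
Lemma min_single_gt0 (x : V) : 0 < min_single f.
Proof.
have max_gt0 : 0 < max_single f.
  by apply: lt_le_trans (f_gt0 x) _; apply: (le_bigmax 0 (fun y => f [set y]) x).
by rewrite /min_single; elim/big_rec: _ => // y m _ m_gt0; rewrite lt_min f_gt0.
Qed.

(** Replaces the ratio in the definition of [thresholds], which depends on the element, by a uniform
    bound. *)
Lemma max_single_div_le_Phi (x : V) : max_single f / f [set x] <= Phi f.
Proof.
rewrite ler_wpM2l //.
  by apply: le_trans (ltW (f_gt0 x)) _; apply: (le_bigmax 0 (fun y => f [set y]) x).
rewrite lef_pV2 ?posrE ?f_gt0 ?(min_single_gt0 x) //.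
exact: (bigmin_le _ x (fun y => f [set y])).
Qed.

Lemma Phi_ge1 (x : V) : 1 <= Phi f.
Proof.
apply: le_trans (max_single_div_le_Phi x); rewrite ler_pdivlMr ?f_gt0 // mul1r.
exact: (le_bigmax 0 (fun y => f [set y]) x).
Qed.

(* ln (1 + eps) = - ln (1 - eps / (1 + eps)) >= eps / (1 + eps) *)
Lemma ln1D_ge_half (eps : R) : 0 < eps <= 1 -> eps / 2 <= ln (1 + eps).
Proof.
case/andP=> eps_gt0 eps_le1; have eps1_gt0 : 0 < 1 + eps by lra.
rewrite -[ln _]opprK -lnV ?posrE //.
have -> : (1 + eps)^-1 = 1 + - (eps / (1 + eps)) by field; rewrite gt_eqF.
have half : eps / 2 <= eps / (1 + eps).
  by rewrite ler_wpM2l ?(ltW eps_gt0) // lef_pV2 ?posrE //; lra.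
have : - (eps / (1 + eps)) > -1.
  by rewrite ltrN2 ltr_pdivrMr // mul1r; lra.
by move/le_ln1Dx; lra.
Qed.

(** Dividing [ln (2 * k * Phi) <= 2 * lg] by [ln (1 + eps) >= eps / 2] gives [4 * lg / eps]; the
    successor is absorbed by a fifth copy, as [lg / eps >= 1]. The maximum with 1 covers the case
    [k * Phi = 1], where the logarithm vanishes. *)
Lemma thresholds_number_le (k : nat) (eps : R) (x : V) :
  (0 < k)%N -> 0 < eps < 1 ->
  (Num.truncn (logb (1 + eps) (2 * k%:R * Phi f))).+1%:R
    <= 5 * (Num.max 1 (logb 2 (k%:R * Phi f)) / eps).
Proof.
move=> k_gt0 /andP[eps_gt0 eps_lt1]; set lg := Num.max _ _.
have lg_ge1 : 1 <= lg by rewrite le_max lexx.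
have Phi1 := Phi_ge1 x.
have kPhi_ge1 : 1 <= k%:R * Phi f by rewrite mulr_ege1 // ler1n.
have ln2_gt0 : 0 < ln (2 : R) by rewrite ln_gt0 // ltr1n.
(* Because of this, passing from base 2 to the natural logarithm costs no constant. *)
have ln2_le1 : ln (2 : R) <= 1.
  by have := @le_ln1Dx R 1; rewrite -[1 + 1]/2; apply; lra.
have lnkPhi : ln (k%:R * Phi f) <= lg.
  have : logb 2 (k%:R * Phi f) <= lg by rewrite le_max lexx orbT.
  rewrite /logb ler_pdivrMr // => /le_trans; apply.
  by rewrite ler_piMr // (le_trans _ lg_ge1).
have half : eps / 2 <= ln (1 + eps) by rewrite ln1D_ge_half // eps_gt0 ltW.
have ln_gt : 0 < ln (1 + eps) by apply: lt_le_trans half; rewrite divr_gt0.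
have lnlg : ln (2 * k%:R * Phi f) <= 2 * lg.
  by rewrite -mulrA lnM ?posrE //; lra.
have logb_le : logb (1 + eps) (2 * k%:R * Phi f) <= 4 * (lg / eps).
  rewrite /logb ler_pdivrMr // (le_trans lnlg) //.
  have -> : 2 * lg = 4 * (lg / eps) * (eps / 2) by field; rewrite gt_eqF.
  by rewrite ler_wpM2l // mulr_ge0 // divr_ge0 ?(ltW eps_gt0) // (le_trans _ lg_ge1).
have logb_ge0 : 0 <= logb (1 + eps) (2 * k%:R * Phi f).
  by rewrite divr_ge0 ?(ltW ln_gt) // ln_ge0 // -mulrA; lra.
have : 1 <= lg / eps by rewrite ler_pdivlMr // mul1r; lra.
by move: logb_ge0; rewrite -truncn_le -natr1; lra.
Qed.

Lemma thresholds_size_le (etime : {set V} -> R) (otime : R) (k : nat) (eps : R)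
    (x : V) : (0 < k)%N -> 0 < eps ->
  (size (thresholds f etime otime k eps x).2
     <= (Num.truncn (logb (1 + eps) (2 * k%:R * Phi f))).+1)%N.
Proof.
move=> k_gt0 eps_gt0; rewrite size_map size_iota ltnS le_truncn //.
have ratio_gt0 : 0 < max_single f / f [set x].
  rewrite divr_gt0 ?f_gt0 //; apply: lt_le_trans (f_gt0 x) _.
  exact: (le_bigmax 0 (fun y => f [set y]) x).
have Phi_gt0 := lt_le_trans ltr01 (Phi_ge1 x).
have k2_gt0 : 0 < 2 * k%:R :> R by rewrite mulr_gt0 ?ltr0n.
rewrite /logb ler_wpM2r // ?invr_ge0 ?ln_ge0 ?lerDl ?(ltW eps_gt0) //.
rewrite -[X in ln X <= _]mulrA ler_ln ?posrE ?(mulr_gt0 k2_gt0) //.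
by rewrite ler_pM2l // max_single_div_le_Phi.
Qed.

End Thresholds.

(** * Absorbing all terms into one constant *)

Theorem theorem4 (R : realType) :
  exists C : R, 0 < C /\
  forall (V : finType) (f : {set V} -> R) (k W W' : nat) (eps : R)
    (v : nat -> V) (etime : {set V} -> R) (otime L : R),
    (forall S, 0 <= f S) ->
    monotone_setfun f ->
    submodular f ->
    (forall x, 0 < f [set x]) ->
    (1 <= k)%N ->
    (1 <= W' <= W)%N ->
    0 < eps < 1 ->
    (forall S, 0 <= etime S <= L) ->
    0 <= otime <= L ->
    let lg := Num.max 1 (logb 2 (k%:R * Phi f)) in
    (forall n : nat, (1 <= n)%N ->
       average_update_time f etime otime k W W' eps v n
         <= C * (L * k%:R * lg * W%:R / (W'%:R * eps))) /\
    (forall t : nat, (1 <= t)%N ->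
       (memory f etime otime k W W' eps v t)%:R
         <= C * (W'%:R + k%:R ^+ 2 * lg * W%:R / (W'%:R * eps))).
Proof.
(* 210 is 21 * 10: the time is at most 21 times [L * k * N * M], and [N * M] is at most 10 times
   [lg * W / (W' * eps)]. The memory needs less. *)
exists 210; split=> // V f k W W' eps v etime otime L _ _ _ f_gt0 k_gt0.
case/andP=> W'_gt0 leW'W eps01 etimeP otimeP lg.
have [eps_gt0 _] := andP eps01.
have sizeT x := thresholds_size_le f f_gt0 etime otime k eps x k_gt0 eps_gt0.
set M := (Num.truncn _).+1 in sizeT.
(* The element [v 0], never read by the algorithm, only witnesses that [V] is inhabited. *)
have leM : M%:R <= 5 * (lg / eps) by apply: thresholds_number_le (v 0%N) _ _.
set N := max_subwindows W W'.
have W'R_gt0 : 0 < W'%:R :> R by rewrite ltr0n.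
(* Since [W' <= W], the successor in [N] is at most [W / W']. *)
have leN : N%:R <= 2 * (W%:R / W'%:R) :> R.
  rewrite mulrA ler_pdivlMr // -!natrM ler_nat /N /max_subwindows mulSn.
  by have := leq_divM W W'; lia.
have L_ge0 : 0 <= L by case/andP: otimeP => /le_trans; apply.
have k1 : 1 <= k%:R :> R by rewrite ler1n.
have M1 : 1 <= M%:R :> R by rewrite ler1n.
have N1 : 1 <= N%:R :> R by rewrite ler1n.
have W'1 : 1 <= W'%:R :> R by rewrite ler1n.
have leNM : N%:R * M%:R <= 10 * (lg * W%:R / (W'%:R * eps)).
  have -> : 10 * (lg * W%:R / (W'%:R * eps))
      = 2 * (W%:R / W'%:R) * (5 * (lg / eps)).
    by field; rewrite !gt_eqF.
  by rewrite ler_pM.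
have MN : M%:R <= N%:R * M%:R :> R by rewrite ler_peMl.
have NM : N%:R <= N%:R * M%:R :> R by rewrite ler_peMr.
have NMk : N%:R * M%:R <= k%:R * (N%:R * M%:R) :> R.
  by rewrite ler_peMl // mulr_ge0.
have Mk : k%:R * M%:R <= k%:R * (N%:R * M%:R) :> R by rewrite ler_wpM2l.
split=> [n n_gt0|t t_gt0].
- apply: (@le_trans _ _ (21 * (L * k%:R * (N%:R * M%:R)))); last first.
    have -> : 210 * (L * k%:R * lg * W%:R / (W'%:R * eps))
        = 21 * (L * k%:R * (10 * (lg * W%:R / (W'%:R * eps)))).
      by field; rewrite !gt_eqF.
    by rewrite ler_pM2l // ler_wpM2l // mulr_ge0.
  have : average_update_time f etime otime k W W' eps v n
      <= time_each L k W W' M + time_build L k W' M / W'%:R.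
    exact: average_update_time_le.
  move/le_trans; apply.
  have M1W' : (M%:R + 1) / W'%:R <= M%:R + 1 :> R.
    by rewrite ler_pdivrMr // ler_peMr // addr_ge0.
  have -> : time_build L k W' M / W'%:R
      = L * ((M%:R + 1) / W'%:R + (k%:R + 3) * M%:R).
    by rewrite /time_build; field; rewrite gt_eqF.
  (* Every monomial on the left is at most [k * N * M], and the coefficients add up to 21. *)
  have : M%:R + 2 + N.+1%:R + N%:R * M%:R * (3 * k.+1%:R + k%:R + 3)
      + ((M%:R + 1) / W'%:R + (k%:R + 3) * M%:R)
      <= 21 * (k%:R * (N%:R * M%:R)) :> R.
    by rewrite -(natr1 k) -(natr1 N); lra.
  by move/(ler_wpM2l L_ge0); rewrite /time_each -/N; lra.
- have : (memory f etime otime k W W' eps v t <= memory_bound k W W' M)%N.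
    exact: (@memory_le _ _ _ _ _ L).
  rewrite -(ler_nat R) => /le_trans; apply.
  (* The expanded memory bound has, besides [W'], five monomials, each at most [k ^ 2 * N * M]. *)
  have kk : k%:R * (k%:R * (N%:R * M%:R)) <= k%:R * (k%:R * (10 * (lg * W%:R / (W'%:R * eps)))).
    by rewrite !ler_wpM2l.
  have k2 : k%:R * (N%:R * M%:R) <= k%:R * (k%:R * (N%:R * M%:R)) :> R.
    by rewrite ler_peMl // !mulr_ge0.
  have k3 : k%:R * (k%:R * M%:R) <= k%:R * (k%:R * (N%:R * M%:R)) :> R.
    by rewrite !ler_wpM2l.
  rewrite /memory_bound -/N 2!natrD !natrM -(natr1 k) -(natr1 N); lra.
Qed.
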